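(* Let $\varphi:(0,\infty)\to(0,\infty)$ be an essentially nondecreasing function with $\lim_{t\to\infty}\varphi(t)/t=0$, let $\mathcal{B}$ be a submultiplicative Young function, let $\mathcal{B}^m=\mathcal{B}\circ\cdots\circ\mathcal{B}$ ($m$-fold composition), let $\psi=\mathcal{B}^m\circ\varphi^{1/m}$, let $u_1,\dots,u_m$ be weights and let $u=\prod_{i=1}^m u_i^{1/m}$. Then there is a constant $C$ such that, for all $\vec f=(f_1,\dots,f_m)$, $$\sup_{\lambda>0}\ \left[\frac{1}{\mathcal{B}^m(1/\lambda)}\right]^m u\left(\left\{x\in\mathbb{R}^n:\ \mathcal{M}_{\varphi,\mathcal{B}}\vec f(x)>\lambda^m\right\}\right)^m\le C\prod_{i=1}^m\int_{\mathbb{R}^n}\mathcal{B}^m(|f_i|)\,M_{\psi,L}u_i.$$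
   Context: Here $n,m\ge1$ are integers; $Q$ denotes a cube in $\mathbb{R}^n$ and $|Q|$ its Lebesgue measure. A weight is a nonnegative locally integrable function on $\mathbb{R}^n$, and $u(E)=\int_Eu$. The $f_i$ are measurable functions on $\mathbb{R}^n$. $\varphi$ is essentially nondecreasing if there is a positive constant $\rho$ such that $t\le s$ implies $\varphi(t)\le\rho\,\varphi(s)$. A Young function $\mathcal{B}$ is submultiplicative if $\mathcal{B}(st)\le\mathcal{B}(s)\mathcal{B}(t)$ for all $s,t\ge 0$. $\varphi^{1/m}$ is the pointwise power, so $\psi(t)=\mathcal{B}^m(\varphi(t)^{1/m})$. Averages: $\|f\|_{\mathcal{B},Q}=\inf\{\lambda>0:\frac1{|Q|}\int_Q\mathcal{B}(|f|/\lambda)\le1\}$; $\|f\|_{L,Q}=\frac1{|Q|}\int_Q|f|$. Maximal operators: $\mathcal{M}_{\varphi,\mathcal{B}}\vec f(x)=\sup_{Q\ni x}\varphi(|Q|)\prod_{i=1}^m\|f_i\|_{\mathcal{B},Q}$ and $M_{\psi,L}g(x)=\sup_{Q\ni x}\psi(|Q|)\,\|g\|_{L,Q}$. *)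

(* Defs.v *)
From HB Require Import structures.
From mathcomp Require Import all_boot all_order all_algebra.
From mathcomp Require Import all_classical all_reals all_analysis.
Import Order.TTheory GRing.Theory Num.Theory.
Import numFieldNormedType.Exports.

Set Implicit Arguments.
Unset Strict Implicit.
Unset Printing Implicit Defensive.

Local Open Scope classical_set_scope.
Local Open Scope ring_scope.

(* The index n stands for the dimension n.+1 throughout, so that the ambient
   space is R^(n+1); this encodes "dimension >= 1". *)

Section lebesgue_outer_measure.
Context {R : realType} {n : nat}.
Implicit Types (E : set 'rV[R]_n.+1) (ab : 'rV[R]_n.+1 * 'rV[R]_n.+1).

Definition box ab : set 'rV[R]_n.+1 :=
  [set x | forall i, x 0 i \in `]ab.1 0 i, ab.2 0 i]].

Definition box_vol ab : R := \prod_i Num.max 0 (ab.2 0 i - ab.1 0 i).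

Definition box_cover E : set (('rV[R]_n.+1 * 'rV[R]_n.+1)^nat) :=
  [set F | E `<=` \bigcup_k box (F k)].

Local Open Scope ereal_scope.

Definition lebesgue_outer E : \bar R :=
  ereal_inf [set \sum_(k <oo) (box_vol (F k))%:E | F in box_cover E].

Lemma box_vol_ge0 ab : (0 <= box_vol ab)%R.
Proof. by apply: prodr_ge0 => i _; rewrite le_max lexx. Qed.

Let box_vole_ge0 ab : 0 <= (box_vol ab)%:E.
Proof. by rewrite lee_fin box_vol_ge0. Qed.

Lemma lebesgue_outer_ge0 E : 0 <= lebesgue_outer E.
Proof. by apply: le_ereal_inf_tmp => _ [F _ <-]; exact: nneseries_ge0. Qed.

Lemma le_lebesgue_outer : {homo lebesgue_outer : A B / A `<=` B >-> A <= B}.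
Proof.
move=> A B AB; apply/ereal_inf_le_tmp => x [F BF] <-{x}.
by exists F => //; exact: subset_trans BF.
Qed.

Lemma lebesgue_outer0 : lebesgue_outer set0 = 0.
Proof.
apply/eqP; rewrite eq_le lebesgue_outer_ge0 andbT.
apply: ereal_inf_lbound; exists (fun=> (0%R, 0%R)); first exact: sub0set.
apply: eseries0 => k _ _; rewrite /box_vol/= big_ord_recl/= !mxE subrr.
by rewrite /Num.max ltxx mul0r.
Qed.

Lemma lebesgue_outer_sigma_subadditive : sigma_subadditive lebesgue_outer.
Proof.
move=> A; have [[i ioo]|] := pselect (exists i, lebesgue_outer (A i) = +oo).
  rewrite (eseries_pinfty _ _ ioo) ?leey// => k _.
  by rewrite -ltNye (lt_le_trans _ (lebesgue_outer_ge0 _)).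
rewrite -forallNE => Aoo.
suff add2e (e : {posnum R}) : lebesgue_outer (\bigcup_n A n) <=
    \sum_(i <oo) lebesgue_outer (A i) + e%:num%:E.
  by apply/lee_addgt0Pr => _/posnumP[].
rewrite (le_trans _ (epsilon_trick _ _ _))//; last first.
  by move=> k; exact: lebesgue_outer_ge0.
pose P k F := box_cover (A k) F /\ \sum_(j <oo) (box_vol (F j))%:E <=
  lebesgue_outer (A k) + (e%:num / (2 ^ k.+1)%:R)%:E.
have [G PG] : {G & forall k, P k (G k)}.
  apply: (@choice _ _ P) => k; rewrite /P /lebesgue_outer.
  set S := (X in ereal_inf X); move infS : (ereal_inf S) => iS.
  case: iS infS => [r Sr|Soo|Soo].
  - have e0 : (0 < e%:num / (2 ^ k.+1)%:R)%R by [].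
    have /(lb_ereal_inf_adherent e0) : ereal_inf S \is a fin_num by rewrite Sr.
    move=> [x [F AF muFx] xS].
    by exists F; split => //; rewrite muFx -Sr; exact/ltW.
  - by have := Aoo k; rewrite /lebesgue_outer Soo.
  - suff : lbound S 0 by move/le_ereal_inf_tmp; rewrite Soo.
    by move=> /= _ [F AF <-]; exact: nneseries_ge0.
pose w ij := (box_vol (uncurry G ij))%:E.
have w_ge0 ij : 0 <= w ij by exact: box_vole_ge0.
apply: (@le_trans _ _ (\esum_(ij in setT) w ij)).
  apply: ereal_inf_lbound => /=.
  have /card_esym/ppcard_eqP[f] := card_nat2.
  exists (uncurry G \o f).
    move=> t [i _ /((PG i).1)[j _ Gijt]].
    by exists (f^-1%FUN (i, j)) => //=; rewrite invK ?inE.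
  rewrite -(esum_pred_image w _ xpredT) ?[fun=> _]set_true//.
  by rewrite image_eq.
rewrite (_ : esum _ _ = \sum_(i <oo) \sum_(j <oo) w (i, j)); last first.
  pose J : nat -> set (nat * nat) := fun i => [set (i, j) | j in setT].
  rewrite (_ : setT = \bigcup_k J k); last first.
    by rewrite predeqE => -[a b]; split => // _; exists a => //; exists b.
  rewrite esum_bigcupT /=; last 2 first.
    - apply/trivIsetP => i j _ _ ij.
      rewrite predeqE => -[k l] /=; split => //= -[] [_] _ [<-{k} _].
      by move=> [l' _] [] /esym/eqP; rewrite (negbTE ij).
    - by [].
  rewrite -(image_id [set: nat]) -fun_true esum_pred_image//; last first.
    by move=> k _; exact: esum_ge0.
  apply: eq_eseriesr => /= j _.
  rewrite -(esum_pred_image w (pair j) predT)//=; last first.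
    by move=> ? ? _ _; exact: (@can_inj _ _ _ snd).
  by congr esum; rewrite predeqE => -[a b]; split; move=> [i _ <-]; exists i.
apply: lee_lim.
- apply: is_cvg_nneseries => k *.
  by apply: nneseries_ge0 => l *; exact: (w_ge0 (k, l)).
- apply: is_cvg_nneseries => k *.
  by apply: adde_ge0 => //; exact: lebesgue_outer_ge0.
- by near=> k; apply: lee_sum => i _; exact: (PG i).2.
Unshelve. all: by end_near. Qed.

HB.instance Definition _ := isOuterMeasure.Build R 'rV[R]_n.+1 lebesgue_outer
  lebesgue_outer0 lebesgue_outer_ge0 le_lebesgue_outer
  lebesgue_outer_sigma_subadditive.

End lebesgue_outer_measure.

Section lebesgue_measure.
Context (R : realType) (n : nat).

(* R^(n+1) with the sigma-algebra of Lebesgue measurable sets *)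
Definition Rn : Type := caratheodory_type (@lebesgue_outer R n).

HB.instance Definition _ := Pointed.on Rn.
HB.instance Definition _ := @isMeasurable.Build
  (caratheodory_display (@lebesgue_outer R n)) Rn
  (caratheodory_measurable (@lebesgue_outer R n))
  (caratheodory_measurable_set0 (@lebesgue_outer R n))
  (@caratheodory_measurable_setC _ _ (@lebesgue_outer R n))
  (@caratheodory_measurable_bigcup _ _ (@lebesgue_outer R n)).

Definition leb : set Rn -> \bar R := @lebesgue_outer R n.

HB.instance Definition _ := isMeasure.Build _ Rn R leb
  (@caratheodory_measure0 _ _ (@lebesgue_outer R n))
  (@caratheodory_measure_ge0 _ _ (@lebesgue_outer R n))
  (@caratheodory_measure_sigma_additive _ _ (@lebesgue_outer R n)).

End lebesgue_measure.
Arguments leb {R n}.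

Section orlicz_maximal.
Context {R : realType} {n : nat}.
Implicit Types (Q : set (Rn R n)) (phi psi B : R -> R) (f g u : Rn R n -> R).

(* compactness is taken in the usual topology of 'rV[R]_n.+1 *)
Definition weight u :=
  [/\ measurable_fun [set: Rn R n] u,
      forall x, 0 <= u x &
      forall K : set 'rV[R]_n.+1, compact K ->
        (\int[leb]_(x in (K : set (Rn R n))) (u x)%:E < +oo)%E].

Definition wmeasure u (E : set (Rn R n)) : \bar R :=
  (\int[leb]_(x in E) (u x)%:E)%E.

(* closed cubes of positive side length, with sides parallel to the axes *)
Definition cube Q := exists (a : 'rV[R]_n.+1) (l : R), 0 < l /\
  Q = [set x : 'rV[R]_n.+1 | forall i, x 0 i \in `[a 0 i, a 0 i + l]].

Definition vol Q : R := fine (leb Q).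

Definition avg Q (F : Rn R n -> R) : \bar R :=
  ((vol Q)^-1%:E * \int[leb]_(x in Q) (F x)%:E)%E.

(* Luxemburg average; it is +oo when no l is admissible *)
Definition luxemburg B f Q : \bar R :=
  ereal_inf [set l%:E | l in [set l : R |
    0 < l /\ (avg Q (fun x => B (`|f x| / l))%R <= 1)%E]].

(* In a product of extended reals, 0 * +oo = 0. *)
Definition maximal_multi (m : nat) phi B (f : 'I_m -> Rn R n -> R)
    (x : Rn R n) : \bar R :=
  ereal_sup [set (phi (vol Q))%:E * \prod_(i < m) luxemburg B (f i) Q |
    Q in [set Q | cube Q /\ Q x]]%E.

Definition maximal_L psi g (x : Rn R n) : \bar R :=
  ereal_sup [set (psi (vol Q))%:E * avg Q (fun y => `|g y|%R) |
    Q in [set Q | cube Q /\ Q x]]%E.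

End orlicz_maximal.

Section young.
Context {R : realType}.
Implicit Types (phi B : R -> R).

(* only the values of phi on (0, +oo) and of B on [0, +oo) are constrained *)
Definition ess_nondecreasing phi := exists2 rho : R, 0 < rho &
  forall t s : R, 0 < t -> t <= s -> phi t <= rho * phi s.

Definition young B :=
  [/\ B 0 = 0,
      forall s t : R, 0 <= s -> s <= t -> B s <= B t,
      convex_function (`[0, +oo[%classic : set R) B &
      B t @[t --> +oo] --> +oo].

Definition submultiplicative B :=
  forall s t : R, 0 <= s -> 0 <= t -> B (s * t) <= B s * B t.

Definition psi_of (m : nat) phi B (t : R) : R :=
  iter m B (phi t `^ m%:R^-1).

End young.

(* Main.v *)
Require Import Defs.
From mathcomp Require Import all_boot all_order all_algebra.
From mathcomp Require Import all_classical all_reals all_analysis.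
From mathcomp Require Import measurable_realfun ring lra.
Import Order.TTheory GRing.Theory Num.Theory.
Import numFieldNormedType.Exports.
Local Open Scope classical_set_scope.
Local Open Scope ring_scope.

(** Write B^m for the m-fold iterate, v = |Q|, and let x belong to the level
set at height lam^m, so that lam^m < phi(v) prod_i ||f_i||_{B,Q} for some cube
Q containing x.

Local estimate. Choose reals s_i < ||f_i||_{B,Q} with
lam^m <= phi(v) prod_i s_i; then the average of B(|f_i|/s_i) over Q exceeds 1.
With K = 2 B(1), values t < 1/K contribute less than 1/2 to this average, so
the average of B(K|f_i|/s_i) over the points where K|f_i|/s_i >= 1 is at least
1/2. For t_1, ..., t_m >= 1 one has prod_i B(t_i) <= B^m(prod_i t_i)
([prod_young_le_iter]). Applied at m independent points x_1, ..., x_m of Q, and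
followed by submultiplicativity, it bounds the product of these truncated
functions by a constant times
(psi(v) B^m(1/lam))^m prod_i B^m(|f_i(x_i)|). Integrating the variables one
after the other gives
(v/2)^m <= c (psi(v) B^m(1/lam))^m prod_i int_Q B^m(|f_i|)
([vol_pow_le_prod_integral]).

Passage to the weights. Let 5Q be the concentric dilation of Q. By Hoelder,
u(5Q)^m <= prod_i u_i(5Q), and psi(v) u_i(5Q) / v is at most a constant times
M_{psi,L} u_i at every point of Q, because phi is essentially nondecreasing and
5Q is a competitor in the supremum. Hence
u(5Q)^m <= C B^m(1/lam)^m prod_i e_i(Q) int_Q B^m(|f_i|), where
e_i(Q) <= M_{psi,L} u_i on Q ([exceeds_wmeasure_le]).

Covering. Countably many of the cubes Q have threefold dilations that cover the
level set, and among finitely many of them Vitali's selection keeps disjoint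
ones whose fivefold dilations cover those threefold dilations
([wmeasure_cubes_le]). Over disjoint cubes the terms e_i(Q) int_Q B^m(|f_i|)
add up to at most int B^m(|f_i|) M_{psi,L} u_i, and the discrete Hoelder
inequality [holder_sum] turns the sum of the u(5Q) into the product of these
integrals ([weak_type_estimate]). *)

(** * Products of extended reals, roots *)

Lemma lee_prode (R : realDomainType) (I : Type) (r : seq I)
    (f g : I -> \bar R) : (forall i, 0 <= f i <= g i)%E ->
  (\prod_(i <- r) f i <= \prod_(i <- r) g i)%E.
Proof.
move=> fg; have f0 i : (0 <= f i)%E by case/andP: (fg i).
elim: r => [|i r IH]; first by rewrite !big_nil.
by rewrite !big_cons lee_pmul ?prode_ge0//; case/andP: (fg i).
Qed.

Lemma lee_expe2r (R : realDomainType) (k : nat) (x y : \bar R) :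
  (0 <= x)%E -> (x <= y)%E -> (x ^+ k <= y ^+ k)%E.
Proof.
by move=> x0 xy; elim: k => // k IH; rewrite !expeS lee_pmul ?expe_ge0.
Qed.

Lemma powR_inv_exprK (R : realType) (m : nat) (a : R) : (0 < m)%N -> 0 <= a ->
  (a `^ m%:R^-1) ^+ m = a.
Proof.
move=> m0 a0; rewrite -(powR_mulrn m (powR_ge0 _ _)) -powRrM mulVf ?powRr1//.
by rewrite pnatr_eq0 -lt0n.
Qed.

(** * Submultiplicative Young functions *)

Section submultiplicative_young.
Context {R : realType} {B : R -> R}.
Hypotheses (B_young : young B) (B_submul : submultiplicative B).

Lemma young_ge0 t : 0 <= t -> 0 <= B t.
Proof. by case: B_young => B0 Bm _ _ t0; rewrite -B0; exact: Bm. Qed.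

(** A zero of B at t > 0 would force B <= 0 everywhere, since every s is
(s / t) * t; this contradicts the growth of B at infinity. *)
Lemma young_gt0 t : 0 < t -> 0 < B t.
Proof.
move=> t0; rewrite lt_neqAle young_ge0 ?ltW// andbT; apply/eqP => Bt.
have B_le0 s : 0 <= s -> B s <= 0.
  move=> s0; rewrite -[s](divfK (lt0r_neq0 t0)).
  have := B_submul (s / t) t (divr_ge0 s0 (ltW t0)) (ltW t0).
  by rewrite -Bt mulr0.
case: B_young => _ _ _ /cvgryPgt /(_ 0) [M [_ BM]].
have := BM (Num.max M 0 + 1); rewrite ltr_pwDr// ?le_max ?lexx// => /(_ erefl).
by rewrite ltNge B_le0// addr_ge0// le_max lexx orbT.
Qed.

Lemma young1_ge1 : 1 <= B 1.
Proof.
have := B_submul 1 1 ler01 ler01; rewrite mulr1 -{1}[B 1]mulr1.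
by rewrite ler_pM2l// young_gt0.
Qed.

(** The graph of B lies below its chord from the origin to
(t * x, B (t * x)). *)
Lemma young_superhom (t x : R) : 1 <= t -> 0 <= x -> t * B x <= B (t * x).
Proof.
move=> t1 x0; have t0 : 0 < t by rewrite (lt_le_trans _ t1).
case: B_young => B0 _ Bconv _.
have tV01 : (0 <= t^-1 <= 1) by rewrite invr_ge0 ltW//= invf_le1.
pose p : {i01 R} := @Itv01 _ t^-1 (andP tV01).1 (andP tV01).2.
have := Bconv p (t * x) 0; rewrite !inE/= !in_itv/= !andbT lexx.
move=> /(_ (mulr_ge0 (ltW t0) x0) isT).
rewrite convRE/= B0 mulr0 addr0 ler_pdivlMl//.
apply: le_trans; rewrite ler_pM2l// le_eqVlt; apply/orP; left.
apply/eqP; congr B; transitivity (t^-1 * (t * x) + (1 - t^-1) * 0) => //.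
by rewrite mulr0 addr0 mulKf ?gt_eqF.
Qed.

Lemma iter_young_ge0 k t : 0 <= t -> 0 <= iter k B t.
Proof. by move=> t0; elim: k => //= k; exact: young_ge0. Qed.

Lemma iter_young_gt0 k t : 0 < t -> 0 < iter k B t.
Proof. by move=> t0; elim: k => //= k; exact: young_gt0. Qed.

Lemma iter_young_mono k s t : 0 <= s -> s <= t -> iter k B s <= iter k B t.
Proof.
move=> s0 st; elim: k => //= k IH; case: B_young => _ Bm _ _.
by apply: Bm => //; exact: iter_young_ge0.
Qed.

Lemma iter_young_submul k s t : 0 <= s -> 0 <= t ->
  iter k B (s * t) <= iter k B s * iter k B t.
Proof.
move=> s0 t0; elim: k => //= k IH.
apply: le_trans (B_submul _ _ (iter_young_ge0 k _ s0) (iter_young_ge0 k _ t0)).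
case: B_young => _ Bm _ _; apply: Bm => //.
by apply: iter_young_ge0; exact: mulr_ge0.
Qed.

Lemma iter_young_superhom k t x :
  1 <= t -> 0 <= x -> t * iter k B x <= iter k B (t * x).
Proof.
move=> t1 x0; elim: k => //= k IH.
apply: le_trans (young_superhom _ _ t1 (iter_young_ge0 k _ x0)) _.
case: B_young => _ Bm _ _; apply: Bm => //.
by rewrite mulr_ge0 ?(le_trans ler01 t1)// iter_young_ge0.
Qed.

Lemma iter_young_prod_submul (I : Type) (r : seq I) k (c : R) (t : I -> R) :
  0 <= c -> (forall i, 0 <= t i) ->
  iter k B (c * \prod_(i <- r) t i) <=
  iter k B c * \prod_(i <- r) iter k B (t i).
Proof.
move=> c0 t0; elim: r => [|i r IH]; first by rewrite !big_nil !mulr1.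
rewrite !big_cons mulrCA (le_trans (iter_young_submul k _ _ (t0 i) _))//.
  by rewrite mulr_ge0// prodr_ge0.
by rewrite mulrCA ler_wpM2l// iter_young_ge0.
Qed.

(** Each further factor costs exactly one iterate: if P is the product of the
earlier ones and k their number, then
B^(k+1)(t P) >= B(t B^k(P)) >= B^k(P) B(t), both steps being superhomogeneity,
with the factors t >= 1 and B^k(P) >= 1. This is the reason for the m-fold
composition in the weak-type estimate. *)
Lemma prod_young_le_iter (I : Type) (r : seq I) (t : I -> R) :
  (forall i, 1 <= t i) ->
  \prod_(i <- r) B (t i) <= iter (size r) B (\prod_(i <- r) t i).
Proof.
move=> t1; have t0 i : 0 <= t i := le_trans ler01 (t1 i).
have Bt1 i : 1 <= B (t i).
  by case: B_young => _ Bm _ _; rewrite (le_trans young1_ge1)// Bm.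
elim: r => [|i r IH]; first by rewrite !big_nil.
rewrite !big_cons /=; set P := \prod_(j <- r) t j.
have BP1 : 1 <= iter (size r) B P.
  by rewrite (le_trans _ IH)//; elim/big_ind: _ => // x y; exact: mulr_ege1.
have P0 : 0 <= P by exact: prodr_ge0.
rewrite (@le_trans _ _ (iter (size r) B P * B (t i)))//.
  by rewrite mulrC ler_wpM2r// (le_trans ler01).
apply: le_trans (young_superhom _ _ BP1 (t0 i)) _.
case: B_young => _ Bm _ _; apply: Bm.
  by rewrite mulr_ge0// iter_young_ge0.
by rewrite mulrC iter_young_superhom.
Qed.

(** Truncation that makes [prod_young_le_iter] applicable to averages of B: an
argument below 1 / (2 B 1) has a value of at most 1/2 by the chord bound
B t <= t * B 1, and the other arguments are rescaled to be at least 1. *)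
Lemma young_le_half_or (t : R) : 0 <= t ->
  B t <= 2^-1 + (if 1 <= 2 * B 1 * t then B (2 * B 1 * t) else 0).
Proof.
move=> t0; have B1 := young1_ge1; have B0 : 0 < B 1 := young_gt0 _ ltr01.
case: B_young => _ Bm _ _; case: ifPn => [_|]; last first.
  rewrite -ltNge addr0 => Kt; have t1 : t < 1 by nra.
  have [->|tn0] := eqVneq t 0; first by case: B_young => ->; rewrite invr_ge0.
  have tp : 0 < t by rewrite lt_neqAle eq_sym tn0.
  have := young_superhom _ _ (ltW (_ : 1 < t^-1)) t0.
  rewrite invf_gt1// mulVf ?gt_eqF// => /(_ t1).
  by rewrite -ler_pdivlMl ?invr_gt0// invrK => Bt; lra.
by rewrite (@le_trans _ _ (B (2 * B 1 * t)))// ?lerDr ?invr_ge0// Bm//; nra.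
Qed.

Lemma measurable_iter_young k d (T : measurableType d) (g : T -> R) :
  measurable_fun setT g -> measurable_fun setT (fun x => iter k B `|g x|).
Proof.
(* B may be arbitrary on the negative reals; cutting them off gives a function
   that is monotone on the whole line. *)
move=> mg; rewrite (_ : (fun x => _) =
    (fun t => iter k B (Num.max 0 t)) \o ((@Num.norm R R) \o g)); last first.
  by apply/funext => x /=; rewrite max_r.
apply: measurableT_comp; last by apply: measurableT_comp.
apply: nondecreasing_measurable => // s t st.
apply: iter_young_mono; first by rewrite le_max lexx.
by rewrite ge_max !le_max lexx st orbT.
Qed.

End submultiplicative_young.

(** * Integrals and the inequality of Hoelder *)

(** The integral of a nonnegative function is the supremum of the integrals of
the simple functions below it, hence monotone for arbitrary functions and
domains. In this form it applies to level sets and to integrals of maximal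
functions. *)
Lemma le_lower_integral d (T : measurableType d) (R : realType)
    (mu : {measure set T -> \bar R}) (D E : set T) (f g : T -> \bar R) :
  D `<=` E -> (forall x, E x -> 0 <= g x)%E ->
  (forall x, D x -> 0 <= f x <= g x)%E ->
  (\int[mu]_(x in D) f x <= \int[mu]_(x in E) g x)%E.
Proof.
move=> DE g0 fg; rewrite !ge0_integralE//; last by move=> x /fg /andP[].
apply: le_ereal_sup => _ [h hf <-]; exists h => // x.
rewrite (le_trans (hf x))// /patch; case: ifPn => xD.
  by rewrite mem_set; [case/andP: (fg x (set_mem xD))|exact/DE/set_mem].
by case: ifPn => // /set_mem; exact: g0.
Qed.

(** The variables x_i are independent, so the inequality can be integrated in
one of them while the others stay fixed; the integrals already formed are
absorbed in the constants c and k. *)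
Lemma prod_integral_le d (T : measurableType d) (R : realType)
    (mu : {measure set T -> \bar R}) (D : set T) (I : eqType) (r : seq I)
    (F G : I -> T -> \bar R) (c k : \bar R) :
  uniq r -> measurable D ->
  (forall i, measurable_fun D (F i)) -> (forall i, measurable_fun D (G i)) ->
  (forall i x, 0 <= F i x)%E -> (forall i x, 0 <= G i x)%E ->
  (0 <= c)%E -> (0 <= k)%E ->
  (forall x : I -> T,
    c * \prod_(i <- r) F i (x i) <= k * \prod_(i <- r) G i (x i))%E ->
  (c * \prod_(i <- r) \int[mu]_(x in D) F i x <=
   k * \prod_(i <- r) \int[mu]_(x in D) G i x)%E.
Proof.
move=> ur mD mF mG F0 G0; elim: r c k ur => [|i r IH] c k.
  by move=> _ _ _ /(_ (fun=> point)); rewrite !big_nil.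
rewrite /= => /andP[ir ur] c0 k0 le_cG; rewrite !big_cons !muleA.
apply: IH => // [||x]; [exact/mule_ge0/integral_ge0..|].
have prodx0 (H : I -> T -> \bar R) : (forall i x, 0 <= H i x)%E ->
  (0 <= \prod_(j <- r) H j (x j))%E by move=> H0; exact: prode_ge0.
rewrite -!muleA !(muleC (\int[mu]_(_ in _) _)%E) !muleA.
rewrite -!ge0_integralZl// ?mule_ge0 ?prodx0//.
apply: le_lower_integral => // y _; rewrite ?mule_ge0 ?prodx0//=.
(* Only the variable of index i varies, its value is y. *)
have := le_cG (fun j => if j == i then y else x j).
have upd (H : I -> T -> \bar R) :
    (\prod_(j <- i :: r) H j (if j == i then y else x j) =
     H i y * \prod_(j <- r) H j (x j))%E.
  rewrite big_cons eqxx; congr (_ * _)%E; apply: eq_big_seq => j jr.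
  by case: eqP jr ir => // -> ->.
by rewrite !upd !muleA (muleAC c) (muleAC k).
Qed.

(** The inequality of arithmetic and geometric means for the numbers a i / A i.
Its right-hand side is linear in a, so it can be summed or integrated; with
A i the sum or the integral of a i, this is the inequality of Hoelder with m
equal exponents. *)
Lemma amgm_weighted (R : realType) (m : nat) (b : R) (a A : 'I_m -> R) :
  (0 < m)%N -> 0 <= b -> (forall i, 0 <= a i) -> (forall i, 0 < A i) ->
  b ^+ m <= \prod_i a i ->
  b <= \sum_i (\prod_j A j) `^ m%:R^-1 / (m%:R * A i) * a i.
Proof.
move=> m0 b0 a0 A0 bma; set P := \prod_j A j; set G := P `^ m%:R^-1.
have P0 : 0 < P by apply: prodr_gt0.
have G0 : 0 < G by exact: powR_gt0.
have Gm : G ^+ m = P by rewrite powR_inv_exprK// ltW.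
rewrite -(@ler_pXn2r _ m)// ?nnegrE//; last first.
  by apply: sumr_ge0 => i _; rewrite mulr_ge0// divr_ge0 ?mulr_ge0// ltW.
apply: le_trans bma _.
have := (@leif_AGM R 'I_m predT (fun i => G / A i * a i)).
rewrite cardE size_enum_ord => /(_ _)[|+ _].
  by move=> i _; rewrite mulr_ge0// divr_ge0// ltW.
rewrite !big_split/= big_const_ord iter_mulr_1 Gm.
rewrite prodfV -/P mulfV ?gt_eqF// mul1r => /le_trans; apply.
rewrite le_eqVlt; apply/orP; left; apply/eqP; congr (_ ^+ _).
rewrite mulr_suml; apply: eq_bigr => i _; rewrite invfM; ring.
Qed.

(** For a = A the bound of [amgm_weighted] is the geometric mean of the A i. *)
Lemma mean_weights (R : realType) (m : nat) (A : 'I_m -> R) : (0 < m)%N ->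
  (forall i, 0 < A i) ->
  \sum_i (\prod_j A j) `^ m%:R^-1 / (m%:R * A i) * A i =
  (\prod_j A j) `^ m%:R^-1.
Proof.
move=> m0 A0; set G := _ `^ _.
transitivity (\sum_(i < m) G / m%:R); last first.
  rewrite big_const_ord iter_addr_0 -(mulr_natr (G / _)).
  by rewrite divfK// pnatr_eq0 -lt0n.
by apply: eq_bigr => i _; rewrite invfM mulrA divfK// gt_eqF.
Qed.

Lemma holder_sum (R : realType) (m : nat) (I : eqType) (s : seq I)
    (b : I -> R) (a : 'I_m -> I -> R) (A : 'I_m -> R) : (0 < m)%N ->
  (forall j, 0 <= b j) -> (forall i j, 0 <= a i j) -> (forall i, 0 < A i) ->
  (forall j, j \in s -> b j ^+ m <= \prod_i a i j) ->
  (forall i, \sum_(j <- s) a i j <= A i) ->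
  \sum_(j <- s) b j <= (\prod_i A i) `^ m%:R^-1.
Proof.
move=> m0 b0 a0 A0 ba aA; rewrite -[leRHS]mean_weights//.
apply: (@le_trans _ _ (\sum_(j <- s)
    \sum_i (\prod_j A j) `^ m%:R^-1 / (m%:R * A i) * a i j)).
  rewrite big_seq [leRHS]big_seq.
  by apply: ler_sum => j js; apply: amgm_weighted => //; exact: ba.
rewrite exchange_big; apply: ler_sum => i _; rewrite -mulr_sumr.
by rewrite ler_wpM2l// divr_ge0 ?powR_ge0// mulr_ge0// ltW.
Qed.

Lemma holder_integral d (T : measurableType d) (R : realType)
    (mu : {measure set T -> \bar R}) (D : set T) (m : nat)
    (b : T -> R) (a : 'I_m -> T -> R) (A : 'I_m -> R) :
  measurable D -> (forall i, measurable_fun D (a i)) -> (0 < m)%N ->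
  (forall x, 0 <= b x) -> (forall i x, 0 <= a i x) -> (forall i, 0 < A i) ->
  (forall x, b x ^+ m <= \prod_i a i x) ->
  (forall i, \int[mu]_(x in D) (a i x)%:E <= (A i)%:E)%E ->
  (\int[mu]_(x in D) (b x)%:E <= ((\prod_i A i) `^ m%:R^-1)%:E)%E.
Proof.
move=> mD ma m0 b0 a0 A0 ba aA; rewrite -[in leRHS]mean_weights//.
pose c i := (\prod_j A j) `^ m%:R^-1 / (m%:R * A i).
have c0 i : 0 <= c i by rewrite divr_ge0 ?powR_ge0// mulr_ge0// ltW.
apply: (@le_trans _ _
    (\int[mu]_(x in D) \sum_i (c i)%:E * (a i x)%:E)%E).
  apply: le_lower_integral => // x _.
    by apply: sume_ge0 => i _; rewrite mule_ge0// lee_fin.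
  rewrite lee_fin b0/= sumEFin lee_fin; exact: amgm_weighted.
rewrite ge0_integral_sum//; last 2 first.
- by move=> i; apply: measurable_funeM; exact/measurable_EFinP.
- by move=> i x _; rewrite mule_ge0// lee_fin.
rewrite -sumEFin; apply: lee_sum => i _.
rewrite ge0_integralZl//; last 3 first.
- exact/measurable_EFinP.
- by move=> x _; rewrite lee_fin.
- by rewrite lee_fin.
by rewrite (EFinM (c i)) lee_wpmul2l// lee_fin.
Qed.

(** The product is a polynomial in e, hence continuous at 0. *)
Lemma le_prod_eps (R : realType) (m : nat) (p : R) (a : 'I_m -> R) :
  (forall e, 0 < e -> p <= \prod_i (a i + e)) -> p <= \prod_i a i.
Proof.
move=> pa; pose q : {poly R} := \prod_i ((a i)%:P + 'X).
have qE x : q.[x] = \prod_i (a i + x).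
  by rewrite horner_prod; apply: eq_bigr => i _; rewrite !hornerE.
have -> : \prod_i a i = lim (q.[x] @[x --> 0^'+]).
  rewrite (cvg_lim _ (cvg_at_right_filter (@continuous_horner _ q 0)))//.
  by rewrite qE; apply: eq_bigr => i _; rewrite addr0.
apply: limr_ge.
  by apply/cvg_ex; exists q.[0]; exact/cvg_at_right_filter/continuous_horner.
by near=> x; rewrite qE; apply: pa.
Unshelve. all: by end_near. Qed.

Lemma holder_integral_lty d (T : measurableType d) (R : realType)
    (mu : {measure set T -> \bar R}) (D : set T) (m : nat)
    (b : T -> R) (a : 'I_m -> T -> R) :
  measurable D -> (forall i, measurable_fun D (a i)) -> (0 < m)%N ->
  (forall x, 0 <= b x) -> (forall i x, 0 <= a i x) ->
  (forall x, b x ^+ m <= \prod_i a i x) ->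
  (forall i, \int[mu]_(x in D) (a i x)%:E < +oo)%E ->
  (\int[mu]_(x in D) (b x)%:E < +oo)%E.
Proof.
move=> mD ma m0 b0 a0 ba aoo.
pose A i := fine (\int[mu]_(x in D) (a i x)%:E)%E + 1.
have ia0 i : (0 <= \int[mu]_(x in D) (a i x)%:E)%E.
  by apply: integral_ge0 => x _; rewrite lee_fin.
apply: (@le_lt_trans _ _ ((\prod_i A i) `^ m%:R^-1)%:E); last exact: ltry.
apply: (@holder_integral _ _ _ _ _ _ _ a) => // i.
  by rewrite ltr_wpDl// fine_ge0.
by rewrite EFinD fineK ?leeDl ?lee_fin// ge0_fin_numE.
Qed.

(** An integral of some a i may vanish, where the weights of
[amgm_weighted] are meaningless: the bounds are first raised by e > 0, and then
e tends to 0. *)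
Lemma holder_integral_prod d (T : measurableType d) (R : realType)
    (mu : {measure set T -> \bar R}) (D : set T) (m : nat)
    (b : T -> R) (a : 'I_m -> T -> R) :
  measurable D -> (forall i, measurable_fun D (a i)) -> (0 < m)%N ->
  (forall x, 0 <= b x) -> (forall i x, 0 <= a i x) ->
  (forall x, b x ^+ m <= \prod_i a i x) ->
  (forall i, \int[mu]_(x in D) (a i x)%:E < +oo)%E ->
  ((\int[mu]_(x in D) (b x)%:E) ^+ m <=
   \prod_i \int[mu]_(x in D) (a i x)%:E)%E.
Proof.
move=> mD ma m0 b0 a0 ba aoo.
have ia0 i : (0 <= \int[mu]_(x in D) (a i x)%:E)%E.
  by apply: integral_ge0 => x _; rewrite lee_fin.
have ib0 : (0 <= \int[mu]_(x in D) (b x)%:E)%E.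
  by apply: integral_ge0 => x _; rewrite lee_fin.
pose A i := fine (\int[mu]_(x in D) (a i x)%:E)%E.
have AE i : (\int[mu]_(x in D) (a i x)%:E)%E = (A i)%:E.
  by rewrite fineK// ge0_fin_numE.
have le_eps (e : R) : 0 < e -> (\int[mu]_(x in D) (b x)%:E <=
    ((\prod_i (A i + e)) `^ m%:R^-1)%:E)%E.
  move=> e0; apply: (@holder_integral _ _ _ _ _ _ _ a) => // i.
    by rewrite ltr_wpDl// -lee_fin -AE.
  by rewrite AE lee_fin lerDl ltW.
have bfin : (\int[mu]_(x in D) (b x)%:E)%E \is a fin_num.
  by rewrite ge0_fin_numE//; exact: (@holder_integral_lty _ _ _ _ _ _ _ a).
rewrite (eq_bigr (fun i => (A i)%:E))// prodEFin -(fineK bfin) -EFin_expe.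
rewrite lee_fin; apply: le_prod_eps => e e0.
have Ae0 : 0 <= \prod_i (A i + e).
  by apply: prodr_ge0 => i _; rewrite addr_ge0 ?(ltW e0)// -lee_fin -AE.
have := le_eps e e0; rewrite -(fineK bfin) lee_fin => /(lerXn2r m).
rewrite !nnegrE fine_ge0// powR_ge0 => /(_ isT isT) /le_trans; apply.
by rewrite powR_inv_exprK.
Qed.

(** * Cubes and their Lebesgue measure *)

Section cubes.
Context {R : realType} {n : nat}.
Implicit Types (a p q x : 'rV[R]_n.+1) (ab : 'rV[R]_n.+1 * 'rV[R]_n.+1)
  (l c s : R) (E : set 'rV[R]_n.+1).

Definition interval_box p q : set (Rn R n) :=
  [set x : 'rV[R]_n.+1 | forall i, x 0 i \in `[p 0 i, q 0 i]].

Definition cube_at a l : set (Rn R n) := interval_box a (a + const_mx l).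

Lemma in_interval_box p q x :
  interval_box p q x <-> forall i, p 0 i <= x 0 i <= q 0 i.
Proof. by split => h i; have := h i; rewrite in_itv. Qed.

Lemma in_cube_at a l x :
  cube_at a l x <-> forall i, a 0 i <= x 0 i <= a 0 i + l.
Proof.
by split => [/in_interval_box|] h; [|apply/in_interval_box] => i;
  have := h i; rewrite !mxE.
Qed.

Lemma cubeP Q : cube Q <-> exists a l, 0 < l /\ Q = cube_at a l.
Proof.
have E a l : [set x : 'rV[R]_n.+1 | forall i, x 0 i \in `[a 0 i, a 0 i + l]]
    = cube_at a l.
  by apply/seteqP; split => x h i; have := h i; rewrite !mxE.
by split => -[a [l [l0 ->]]]; exists a, l; rewrite E.
Qed.

Lemma lebesgue_outer_box ab : (lebesgue_outer (box ab) <= (box_vol ab)%:E)%E.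
Proof.
apply: ereal_inf_lbound.
exists (fun k => if k == 0 then ab else (0, 0)) => /=.
  by move=> x xab; exists 0.
rewrite (nneseries_split _ 1)//; last first.
  by move=> k _; rewrite lee_fin box_vol_ge0.
rewrite big_nat1 eseries0 ?adde0//= => -[|k]//= _ _.
by rewrite /box_vol/= big_ord_recl/= !mxE subrr maxxx mul0r.
Qed.

(** The affine map sends boxes to boxes, hence covers of E to covers of its
image. *)
Lemma lebesgue_outer_affine E s p : 0 < s ->
  (lebesgue_outer [set (s *: x + p)%R | x in E] <=
   (s ^+ n.+1)%:E * lebesgue_outer E)%E.
Proof.
move=> s0; have sn0 : 0 < s ^+ n.+1 by exact: exprn_gt0.
rewrite -lee_pdivrMl//; apply: le_ereal_inf_tmp => _ [F EF <-].
rewrite lee_pdivrMl// -nneseriesZl; last first.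
  by move=> k _; rewrite lee_fin box_vol_ge0.
apply: ereal_inf_lbound.
exists (fun k => (s *: (F k).1 + p, s *: (F k).2 + p)) => /=.
  move=> _ [x /EF[k _ Fkx] <-]; exists k => // i; have := Fkx i.
  by rewrite /= !in_itv/= !mxE ltrD2r lerD2r ltr_pM2l// ler_pM2l.
apply: eq_eseriesr => k _; rewrite -EFinM; congr EFin.
have -> : s ^+ n.+1 = \prod_(i < n.+1) s by rewrite prodr_const card_ord.
rewrite /box_vol -big_split/=.
apply: eq_bigr => i _; rewrite !mxE maxr_pMr ?ltW// mulr0; congr Num.max; ring.
Qed.

(** The hyperplane x_i = c cuts each half-open box into two half-open boxes
with the same total volume, so a cover of E splits into covers of its two
parts; this is the criterion of Caratheodory. *)
Lemma measurable_halfspace_le i c :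
  measurable ([set x : 'rV[R]_n.+1 | x 0 i <= c] : set (Rn R n)).
Proof.
pose cutl (ab : 'rV[R]_n.+1 * 'rV[R]_n.+1) : 'rV[R]_n.+1 * 'rV[R]_n.+1 :=
  (ab.1, \row_j if j == i then Num.min (ab.2 0 j) c else ab.2 0 j).
pose cutr (ab : 'rV[R]_n.+1 * 'rV[R]_n.+1) : 'rV[R]_n.+1 * 'rV[R]_n.+1 :=
  (\row_j if j == i then Num.max (ab.1 0 j) c else ab.1 0 j, ab.2).
have cut_vol ab : box_vol ab = box_vol (cutl ab) + box_vol (cutr ab).
  have D (F : 'I_n.+1 -> R) : \prod_j F j = F i * \prod_(j | j != i) F j.
    by rewrite (bigD1 i).
  rewrite /box_vol !D/= !mxE eqxx.
  set P := \prod_(j | _) _; rewrite [X in _ * X + _](_ : _ = P); last first.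
    by apply: eq_bigr => j ji; rewrite !mxE (negbTE ji).
  rewrite [X in _ + _ * X](_ : _ = P); last first.
    by apply: eq_bigr => j ji; rewrite !mxE (negbTE ji).
  rewrite -mulrDl; congr (_ * _).
  move: (ab.1 0 i) (ab.2 0 i) => u v.
  have max0l (t : R) : t <= 0 -> Num.max 0 t = 0 by move=> t0; rewrite max_l.
  have max0r (t : R) : 0 <= t -> Num.max 0 t = t by move=> t0; rewrite max_r.
  have [uc|cu] := leP u c; have [vc|cv] := leP v c.
  - by rewrite (max0l (v - c)) ?addr0// subr_le0.
  - by rewrite !max0r ?subr_ge0 ?(ltW cv)//; [ring|rewrite (le_trans uc) ?ltW].
  - by rewrite !max0l ?addr0 ?subr_le0 ?(ltW cu) ?(le_trans vc) ?ltW.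
  - by rewrite (max0l (c - u)) ?add0r// subr_le0 ltW.
apply: le_caratheodory_measurable => E.
apply: le_ereal_inf_tmp => _ [F EF <-].
rewrite (eq_eseriesr (fun k _ => congr1 EFin (cut_vol (F k)))).
under eq_eseriesr do rewrite EFinD.
rewrite nneseriesD; [|by move=> k _ _; rewrite lee_fin box_vol_ge0..].
apply: leeD; apply: ereal_inf_lbound.
- exists (cutl \o F) => // x [Ex xc]; have [k _ Fkx] := EF x Ex.
  exists k => // j; have := Fkx j; rewrite /= !in_itv/= !mxE.
  by case: eqP => [->|//]; rewrite le_min xc andbT.
- exists (cutr \o F) => // x [Ex /negP xc]; have [k _ Fkx] := EF x Ex.
  exists k => // j; have := Fkx j; rewrite /= !in_itv/= !mxE.
  by case: eqP => [->|//]; rewrite gt_max (ltNge c) xc andbT.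
Qed.

Lemma measurable_halfspace_ge i c :
  measurable ([set x : 'rV[R]_n.+1 | c <= x 0 i] : set (Rn R n)).
Proof.
rewrite (_ : [set _ | _] = ~` \bigcup_k
    ([set x : 'rV[R]_n.+1 | x 0 i <= c - k.+1%:R^-1] : set (Rn R n))).
  by apply/measurableC/bigcup_measurable => k _; exact: measurable_halfspace_le.
apply/seteqP; split => x /=.
  move=> cx [k _ /=]; apply/negP; rewrite -ltNge (lt_le_trans _ cx)//.
  by rewrite ltrBlDr ltrDl invr_gt0.
apply: contra_notP => /negP; rewrite -ltNge => xc.
have [k kc] := ltr_add_invr xc; exists k => //=.
by rewrite lerBrDr ltW.
Qed.

Lemma measurable_interval_box p q : measurable (interval_box p q).
Proof.
rewrite (_ : interval_box p q = \bigcap_(i in [set: 'I_n.+1])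
  (([set x : 'rV[R]_n.+1 | p 0 i <= x 0 i] : set (Rn R n)) `&`
   ([set x : 'rV[R]_n.+1 | x 0 i <= q 0 i] : set (Rn R n)))); last first.
  apply/seteqP; split => x.
    by move=> /in_interval_box h i _; have /andP[] := h i.
  by move=> h; apply/in_interval_box => i; have [/= -> ->] := h i I.
apply: fin_bigcap_measurable => // i _; apply: measurableI.
  exact: measurable_halfspace_ge.
exact: measurable_halfspace_le.
Qed.

Lemma measurable_cube_at a l : measurable (cube_at a l).
Proof. exact: measurable_interval_box. Qed.

Lemma compact_cube_at a l : compact (cube_at a l : set 'rV[R]_n.+1).
Proof.
apply: (@rV_compact _ _ (fun i => `[a 0 i, (a + const_mx l) 0 i]%classic)).
by move=> i; exact: segment_compact.
Qed.

Lemma leb_cube_at_fin a l : leb (cube_at a l) \is a fin_num.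
Proof.
rewrite ge0_fin_numE//; apply: (@le_lt_trans _ _
    (lebesgue_outer (box (a - const_mx 1, a + const_mx l)))).
  apply: le_lebesgue_outer => x /in_cube_at h i; have /andP[h1 h2] := h i.
  by rewrite /= in_itv/= !mxE h2 andbT (lt_le_trans _ h1)// gtrBl.
by rewrite (le_lt_trans (lebesgue_outer_box _))// ltry.
Qed.

(** The cube concentric with [cube_at a l] and with five times its side. *)
Definition dilate5 a l := cube_at (a - const_mx (2 * l)) (5 * l).

Lemma sub_dilate5 a l : 0 < l -> cube_at a l `<=` dilate5 a l.
Proof.
move=> l0 x /in_cube_at h; apply/in_cube_at => i; have := h i; rewrite !mxE.
lra.
Qed.

Lemma vol_cube_at_ge0 a l : 0 <= vol (cube_at a l).
Proof. exact: fine_ge0. Qed.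

Lemma vol_dilate5_ge a l : 0 < l -> vol (cube_at a l) <= vol (dilate5 a l).
Proof.
move=> l0; rewrite fine_le ?leb_cube_at_fin//.
exact/le_lebesgue_outer/sub_dilate5.
Qed.

Lemma vol_dilate5_le a l : 0 < l ->
  vol (dilate5 a l) <= 5 ^+ n.+1 * vol (cube_at a l).
Proof.
move=> l0; rewrite -lee_fin EFinM !fineK ?leb_cube_at_fin//.
apply: le_trans (lebesgue_outer_affine (cube_at a l) 5
  (- (4%:R *: a) - const_mx (2 * l)) _); last by [].
apply: le_lebesgue_outer => x /in_cube_at h.
(* The preimage of x under the dilation of ratio 5 about the centre of the
   cube. *)
pose y : 'rV[R]_n.+1 := \row_i ((x 0 i + 4 * a 0 i + 2 * l) / 5).
exists y; last first.
  by apply/rowP => i; rewrite !mxE; field.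
by apply/in_cube_at => i; have := h i; rewrite !mxE; lra.
Qed.

End cubes.

(** * Coverings by cubes *)

(** Greedy selection on the list sorted by decreasing size: an element is kept
when it meets no earlier kept one, and otherwise it meets a kept element that
is at least as large. *)
Lemma vitali_finite (R : realType) (T : eqType) (l : T -> R) (meet : rel T)
    (s : seq T) : {in s, forall x, meet x x} ->
  exists t, [/\ {subset t <= s}, pairwise (fun x y => ~~ meet y x) t &
    forall x, x \in s -> exists2 y, y \in t & meet x y && (l x <= l y)].
Proof.
move=> meetxx; pose ge x y := l y <= l x.
have ge_trans : transitive ge by move=> y x z xy yz; exact: le_trans yz xy.
have ge_total : total ge by move=> x y; exact: le_total.
suff: forall s', {in s', forall x, meet x x} -> sorted ge s' ->
    exists t, [/\ {subset t <= s'}, pairwise (fun x y => ~~ meet y x) t &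
    forall x, x \in s' -> exists2 y, y \in t & meet x y && (l x <= l y)].
  move=> /(_ (sort ge s)) [x|//|t [ts pt st]].
  - by rewrite mem_sort; exact: meetxx.
  - exact: sort_sorted.
  exists t; split=> //.
    by move=> x /ts; rewrite mem_sort.
  by move=> x xs; apply: st; rewrite mem_sort.
elim/last_ind => [_ _|s' x IH mxx]; first by exists [::].
rewrite (sorted_pairwise ge_trans) pairwise_rcons => /andP[/allP xmin].
rewrite -(sorted_pairwise ge_trans) => /IH[z zs|t [ts pt st]].
  by apply: mxx; rewrite mem_rcons inE zs orbT.
have [/hasP[y yt xy]|/hasPn noxt] := boolP (has (meet x) t).
  exists t; split=> // z; first by move=> /ts zs; rewrite mem_rcons inE zs orbT.
  rewrite mem_rcons inE => /orP[/eqP->|/st//].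
  by exists y => //; rewrite xy; exact/xmin/ts.
exists (rcons t x); split=> [z||z].
- by rewrite !mem_rcons !inE => /orP[->//|/ts ->]; rewrite orbT.
- by rewrite pairwise_rcons pt andbT; apply/allP => y /noxt.
- rewrite mem_rcons inE => /orP[/eqP->|/st[y yt h]].
    by exists x; rewrite ?mem_rcons ?mem_head// lexx mxx// mem_rcons mem_head.
  by exists y => //; rewrite mem_rcons inE yt orbT.
Qed.

Lemma integral_bigcup_seq_le d (T : measurableType d) (R : realType)
    (mu : {measure set T -> \bar R}) (I : eqType) (t : seq I) (D : I -> set T)
    (V : set T) (u : T -> R) :
  measurable_fun setT u -> (forall x, 0 <= u x) ->
  (forall i, measurable (D i)) ->
  (forall x, V x -> exists2 i, i \in t & D i x) ->
  (\int[mu]_(x in V) (u x)%:E <=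
   \sum_(i <- t) \int[mu]_(x in D i) (u x)%:E)%E.
Proof.
move=> um u0 mD VD.
under eq_bigr do rewrite integral_mkcond.
have uD0 i x : (0 <= ((EFin \o u) \_ (D i)) x)%E.
  by rewrite /patch; case: ifP => //= _; rewrite lee_fin.
rewrite -ge0_integral_sum//; last first.
  move=> i; apply/(measurable_restrictT _ (mD i)).
  by apply: measurable_funTS; exact/measurable_EFinP.
apply: le_lower_integral => // [x _|x /VD[i it Dix]]; first exact: sume_ge0.
by rewrite lee_fin u0/= (big_rem i)//= {1}/patch mem_set//= leeDl// sume_ge0.
Qed.

Section covering.
Context {R : realType} {n : nat}.
Local Notation pos_cube := ('rV[R]_n.+1 * R)%type.
Implicit Types (y z : pos_cube) (t : seq pos_cube).

(** The cube concentric with the given one and with three times its side. *)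
Definition dilate3 y := cube_at (y.1 - const_mx y.2) (3 * y.2).

Definition cubes_meet y z :=
  `[< cube_at y.1 y.2 `&` cube_at z.1 z.2 !=set0 >].

Lemma dilate3_sub_dilate5 y z : cubes_meet y z -> y.2 <= z.2 ->
  dilate3 y `<=` dilate5 z.1 z.2.
Proof.
move=> /asboolP[w [/in_cube_at wy /in_cube_at wz]] yz x /in_cube_at xy.
apply/in_cube_at => i; have := wy i; have := wz i; have := xy i.
by rewrite !mxE; lra.
Qed.

(** Between a cube and its threefold dilation there is room for a box with
rational vertices. One cube of Q is kept for each rational box that lies in the
threefold dilation of a cube of Q. *)
Lemma countable_subcover (Q : set pos_cube) : Q !=set0 ->
  (forall y, Q y -> 0 < y.2) ->
  exists2 sel : nat -> pos_cube, (forall k, Q (sel k)) &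
    \bigcup_(y in Q) cube_at y.1 y.2 `<=` \bigcup_k dilate3 (sel k).
Proof.
move=> [y0 Qy0] Q0.
pose box_of (pq : 'rV[rat]_n.+1 * 'rV[rat]_n.+1) : set (Rn R n) :=
  interval_box (map_mx ratr pq.1) (map_mx ratr pq.2).
pose P (pq : option ('rV[rat]_n.+1 * 'rV[rat]_n.+1)) y := Q y /\
  forall b z, pq = Some b -> Q z -> box_of b `<=` dilate3 z ->
    box_of b `<=` dilate3 y.
have /choice[sel selP] : forall k : nat, exists y, P (unpickle k) y.
  move=> k; case: (unpickle k) => [b|]; last by exists y0; split.
  have [[z [Qz bz]]|nob] := pselect (exists z, Q z /\ box_of b `<=` dilate3 z).
    by exists z; split=> // b' z' [<-] _ _.
  by exists y0; split=> // b' z [<-] Qz bz; case: nob; exists z.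
exists sel => [k|x [y Qy yx]]; first by case: (selP k).
have y20 := Q0 y Qy.
have lo i : exists q : rat, ratr q \in `]y.1 0 i - y.2, y.1 0 i[.
  by apply: rat_in_itvoo; rewrite gtrBl.
have hi i : exists q : rat, ratr q \in `]y.1 0 i + y.2, y.1 0 i + 2 * y.2[.
  by apply: rat_in_itvoo; lra.
have [p pP] := choice lo; have [q qP] := choice hi.
(* A rational box between the cube y and its threefold dilation. *)
pose b : 'rV[rat]_n.+1 * 'rV[rat]_n.+1 := (\row_i p i, \row_i q i).
have bx : box_of b x.
  apply/in_interval_box => i; have := pP i; have := qP i.
  have /in_cube_at /(_ i) := yx.
  by rewrite !in_itv/= !mxE; lra.
have by3 : box_of b `<=` dilate3 y.
  move=> w /in_interval_box bw; apply/in_cube_at => i; have := bw i.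
  by have := pP i; have := qP i; rewrite !in_itv/= !mxE; lra.
exists (pickle b) => //; have [_] := selP (pickle b).
by rewrite pickleK => /(_ b y erefl Qy by3); exact.
Qed.

(** Finite unions of the selected threefold dilations increase to a set that
contains the union of all the cubes; by [vitali_finite] each of them is covered
by the fivefold dilations of disjoint cubes of Q. *)
Lemma wmeasure_cubes_le (Q : set pos_cube) (u : Rn R n -> R) (G : \bar R) :
  (forall y, Q y -> 0 < y.2) ->
  measurable_fun setT u -> (forall x, 0 <= u x) ->
  (forall t, (forall y, y \in t -> Q y) ->
    pairwise (fun y z => ~~ cubes_meet z y) t ->
    \sum_(y <- t) wmeasure u (dilate5 y.1 y.2) <= G)%E ->
  (wmeasure u (\bigcup_(y in Q) cube_at y.1 y.2) <= G)%E.
Proof.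
move=> Q0 mu u0 tG; have [Qe|/set0P Qn] := eqVneq Q set0.
  rewrite Qe bigcup_set0 /wmeasure integral_set0.
  by have := tG [::]; rewrite big_nil; apply.
have [sel selQ Qsel] := countable_subcover Q Qn Q0.
pose V J := \big[setU/set0]_(k < J) dilate3 (sel k).
have mV J : measurable (V J).
  by apply: bigsetU_measurable => k _; exact: measurable_cube_at.
have ndV : {homo V : i j / (i <= j)%N >-> (i <= j)%O}.
  move=> i j ij; apply/subsetPset.
  exact: (@subset_bigsetU _ (dilate3 \o sel)).
have muE D : measurable_fun D (EFin \o u).
  by apply: measurable_funTS; exact/measurable_EFinP.
have VG J : (wmeasure u (V J) <= G)%E.
  have meetxx : {in [seq sel k | k <- iota 0 J], forall y, cubes_meet y y}.
    move=> _ /mapP[k _ ->]; apply/asboolP; exists (sel k).1; split;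
    apply/in_cube_at => i; rewrite lexx lerDl ltW//; exact: Q0.
  have [t [tsel ptw selt]] := @vitali_finite _ _ snd cubes_meet _ meetxx.
  have tQ y : y \in t -> Q y by move=> /tsel /mapP[k _ ->].
  apply: le_trans (tG t tQ ptw).
  apply: integral_bigcup_seq_le => // [y|x]; first exact: measurable_cube_at.
  rewrite /V -(bigcup_mkord _ (fun k => dilate3 (sel k))) => -[k /= kJ xk].
  have /selt[y yt /andP[meet le]] : sel k \in [seq sel k | k <- iota 0 J].
    by apply: map_f; rewrite mem_iota.
  by exists y => //; exact: dilate3_sub_dilate5 xk.
have cvgV := @ge0_nondecreasing_set_cvg_integral _ _ _ V (EFin \o u) leb
  ndV mV (fun J => muE (V J)) (fun J x _ => u0 x).
apply: (@le_trans _ _ (wmeasure u (\bigcup_J V J))).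
  apply: le_lower_integral => [x /Qsel[k _ xk]|x _|x _].
  - by exists k.+1 => //; rewrite /V big_ord_recr/=; right.
  - by rewrite lee_fin.
  - by rewrite lee_fin u0/=.
suff : (\int[leb]_(x in \bigcup_J V J) (EFin \o u) x <= G)%E by [].
rewrite -(cvg_lim _ cvgV)//; apply: lime_le; first exact: cvgP cvgV.
by near=> J; exact: VG.
Unshelve. all: by end_near. Qed.

End covering.

(** * Luxemburg averages *)

Lemma lt_mule_lower (R : realType) (a : R) (y x : \bar R) :
  0 <= a -> (0 <= y)%E -> (0 <= x)%E -> (a%:E < y * x)%E ->
  exists s : R, [/\ 0 < s, (s%:E < x)%E & (a%:E < y * s%:E)%E].
Proof.
move=> a0 y0 x0 ayx.
have x_gt0 : (0 < x)%E.
  rewrite lt_neqAle x0 andbT; apply: contraTneq ayx => <-.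
  by rewrite mule0 -leNgt lee_fin.
have y_gt0 : (0 < y)%E.
  rewrite lt_neqAle y0 andbT; apply: contraTneq ayx => <-.
  by rewrite mul0e -leNgt lee_fin.
case: y y_gt0 ayx {y0} => [q|_ _|//]; last first.
  have [s [s0 sx]] : exists s : R, 0 < s /\ (s%:E < x)%E.
    case: x x_gt0 {x0} => [r r0|_|//]; last by exists 1; rewrite ltry.
    by exists (r / 2); rewrite lte_fin; move: r0; rewrite lte_fin; lra.
  by exists s; rewrite gt0_mulye ?ltry ?lte_fin.
rewrite lte_fin => q0; case: x x_gt0 {x0} => [r r0|_ _|//]; last first.
  exists (a / q + 1); rewrite ltry ltr_wpDl ?divr_ge0 ?(ltW q0)//.
  by rewrite -EFinM lte_fin mulrDr mulrCA divff ?gt_eqF// !mulr1 ltrDl.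
rewrite -EFinM lte_fin => aqr.
have aq : a / q < r by rewrite ltr_pdivrMr// mulrC.
have aq0 : 0 <= a / q by rewrite divr_ge0// ltW.
exists ((a / q + r) / 2); rewrite -EFinM !lte_fin; split; [lra|lra|].
by rewrite mulrA mulrDr mulrCA divff ?gt_eqF// mulr1; lra.
Qed.

(** Replaces possibly infinite factors by smaller finite ones, one at a time,
without losing the strict inequality. *)
Lemma lt_prode_lower (R : realType) (I : eqType) (r : seq I) (a : R)
    (y : \bar R) (x : I -> \bar R) :
  uniq r -> 0 <= a -> (0 <= y)%E -> (forall i, 0 <= x i)%E ->
  (a%:E < y * \prod_(i <- r) x i)%E ->
  exists s : I -> R, (forall i, i \in r -> 0 < s i /\ ((s i)%:E < x i)%E) /\
    (a%:E < y * (\prod_(i <- r) s i)%:E)%E.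
Proof.
move=> + a0 + x0; elim: r y => [|i r IH] y.
  by move=> _ _; rewrite big_nil => h; exists (fun=> 1); rewrite big_nil.
rewrite /= => /andP[ir ur] y0; rewrite big_cons [X in (y * X)%E]muleC muleA.
have P0 : (0 <= \prod_(j <- r) x j)%E by exact: prode_ge0.
move=> /(lt_mule_lower _ _ _ _ a0 (mule_ge0 y0 P0) (x0 i)) [e [e0 ex]].
have ye0 : (0 <= y * e%:E)%E by rewrite mule_ge0// lee_fin ltW.
rewrite muleAC => /(IH _ ur ye0)[s [sx ays]].
have si j : j \in r -> (if j == i then e else s j) = s j.
  by case: eqP ir => // ->; move=> /negP.
exists (fun j => if j == i then e else s j); split.
  move=> j; rewrite inE; case: eqP => [->//|_ /= jr].
  by have := sx j jr.
rewrite big_cons eqxx (eq_big_seq _ si) EFinM muleA.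
exact: ays.
Qed.

Section orlicz_average.
Context {R : realType} {n : nat} (B : R -> R).
Hypotheses (B_young : young B) (B_submul : submultiplicative B).
Implicit Types (Q : set (Rn R n)) (f : Rn R n -> R).

Lemma luxemburg_ge0 f Q : (0 <= luxemburg B f Q)%E.
Proof.
by apply: le_ereal_inf_tmp => _ [l [l0 _] <-]; rewrite lee_fin ltW.
Qed.

Lemma avg_gt1_lt_luxemburg f Q (s : R) : 0 < s -> (s%:E < luxemburg B f Q)%E ->
  (1 < avg Q (fun x => B (`|f x| / s)))%E.
Proof.
move=> s0; rewrite !ltNge; apply: contra => avg1.
by apply: ereal_inf_lbound; exists s.
Qed.

(** B restricted to the arguments for which [prod_young_le_iter] holds. It is
monotone on the whole line, hence a Borel function. *)
Definition large_young (t : R) := if 1 <= t then B t else 0.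

Lemma large_young_ge0 t : 0 <= large_young t.
Proof.
rewrite /large_young; case: ifPn => // t1.
by rewrite young_ge0// (le_trans ler01).
Qed.

Lemma measurable_large_young : measurable_fun setT large_young.
Proof.
apply: nondecreasing_measurable => // s t st.
rewrite {1}/large_young; case: ifPn => [s1|_]; last exact: large_young_ge0.
rewrite /large_young (le_trans s1 st).
by case: B_young => _ Bm _ _; rewrite Bm// (le_trans ler01 s1).
Qed.

Lemma measurable_large_quotient d (T : measurableType d) (g : T -> R) (s : R) :
  measurable_fun setT g ->
  measurable_fun setT (fun x => large_young (2 * B 1 * (`|g x| / s))).
Proof.
move=> mg; apply: (measurableT_comp measurable_large_young).
apply: measurable_funM => //; apply: measurable_funM => //.
exact: measurableT_comp.
Qed.

(** Below its Luxemburg norm, f / s has an average of B larger than 1, of which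
the truncation of [young_le_half_or] removes at most one half. *)
Lemma half_vol_le_integral_large f Q (s : R) :
  measurable Q -> leb Q \is a fin_num -> measurable_fun setT f ->
  0 < s -> 0 < vol Q -> (s%:E < luxemburg B f Q)%E ->
  ((vol Q / 2)%:E <=
   \int[leb]_(x in Q) (large_young (2 * B 1 * (`|f x| / s)))%:E)%E.
Proof.
move=> mQ Qfin mf s0 v0 /(avg_gt1_lt_luxemburg _ _ _ s0).
set K := 2 * B 1; rewrite /avg -lte_pdivrMl ?invr_gt0// invrK mule1 => lt_int.
have mF : measurable_fun setT (fun x => large_young (K * (`|f x| / s))).
  exact: measurable_large_quotient.
have mEF : measurable_fun Q (fun x => (large_young (K * (`|f x| / s)))%:E).
  by apply: measurable_funTS; exact/measurable_EFinP.
have F0 x : (0 <= (large_young (K * (`|f x| / s)))%:E)%E.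
  by rewrite lee_fin large_young_ge0.
have : (\int[leb]_(x in Q) (B (`|f x| / s))%:E <= (vol Q / 2)%:E +
    \int[leb]_(x in Q) (large_young (K * (`|f x| / s)))%:E)%E.
  have -> : (vol Q / 2)%:E = (\int[leb]_(x in Q) (cst (2^-1)%:E) x)%E.
    rewrite integral_cst//; transitivity ((2^-1)%:E * (vol Q)%:E)%E.
      by rewrite -EFinM mulrC.
    by rewrite fineK.
  rewrite -ge0_integralD//; last first.
    by move=> x _; rewrite lee_fin invr_ge0.
  apply: le_lower_integral => // x _.
    by rewrite adde_ge0//= lee_fin invr_ge0.
  have t0 : 0 <= `|f x| / s by rewrite divr_ge0// ltW.
  rewrite lee_fin young_ge0//= -EFinD lee_fin; exact: young_le_half_or.
move=> /(lt_le_trans lt_int) /ltW.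
rewrite {1}(_ : vol Q = vol Q / 2 + vol Q / 2); last by field.
by rewrite EFinD leeD2lE.
Qed.

(** On a null set every average is 0, so that every s > 0 is admissible. *)
Lemma vol_gt0_of_luxemburg f Q : (0 < luxemburg B f Q)%E -> 0 < vol Q.
Proof.
move=> lux0; have := @lt_mule_lower R 0 1%:E (luxemburg B f Q) (lexx 0) _ _.
rewrite mul1e => /(_ _ _ lux0)[||s [s0 /(avg_gt1_lt_luxemburg _ _ _ s0)]].
- by rewrite lee_fin.
- exact: luxemburg_ge0.
move=> + _; rewrite lt0r [0 <= vol Q]fine_ge0// andbT; apply: contraTneq => v0.
by rewrite /avg v0 invr0 mul0e -leNgt lee_fin.
Qed.

(** The case where all the arguments are at least 1 is [prod_young_le_iter] at
their product, in which the s i occur only through prod s i >= lam^m / p. This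
trades the unknown s i for w = p^(1/m) / lam, the same for all i. *)
Lemma large_product_le (m : nat) (s t : 'I_m -> R) (p lam : R) :
  (0 < m)%N -> 0 < lam -> 0 < p ->
  (forall i, 0 < s i) -> (forall i, 0 <= t i) ->
  lam ^+ m <= p * \prod_i s i ->
  \prod_i large_young (2 * B 1 * (t i / s i)) <=
  iter m B ((2 * B 1) ^+ m) * (iter m B (p `^ m%:R^-1) * iter m B lam^-1) ^+ m *
  \prod_i iter m B (t i).
Proof.
move=> m0 lam0 p0 s0 t0 lam_le; set K := 2 * B 1.
have K0 : 0 < K by rewrite mulr_gt0// young_gt0.
have B0 k x : 0 <= x -> 0 <= iter k B x by exact: iter_young_ge0.
pose w := p `^ m%:R^-1 / lam.
have w0 : 0 < w by rewrite divr_gt0// powR_gt0.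
have wm : w ^+ m = p / lam ^+ m.
  by rewrite expr_div_n powR_inv_exprK// ltW.
have [/forallP all1|] := boolP [forall i, 1 <= K * (t i / s i)]; last first.
  rewrite negb_forall => /existsP[i]; rewrite -ltNge => lt1.
  rewrite (bigD1 i)//= {1}/large_young (leNgt 1) lt1/= mul0r.
  rewrite mulr_ge0//; last by apply: prodr_ge0 => j _; exact: B0.
  rewrite mulr_ge0 ?exprn_ge0 ?mulr_ge0 ?B0 ?exprn_ge0 ?powR_ge0//.
    exact: ltW.
  by rewrite invr_ge0 ltW.
rewrite (eq_bigr (fun i => B (K * (t i / s i)))); last first.
  by move=> i _; rewrite /large_young all1.
apply: le_trans (prod_young_le_iter B_young B_submul _ _ _ all1) _.
(* The number of iterates is the length of the enumeration of 'I_m. *)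
rewrite [X in iter X](_ : _ = m); last first.
  by rewrite -[RHS](card_ord m) cardE enumT.
have prod_le : \prod_i (K * (t i / s i)) <= K ^+ m * \prod_i (w * t i).
  clearbody K w; rewrite !big_split/= prodfV !big_const_ord !iter_mulr_1.
  rewrite ler_wpM2l ?exprn_ge0 ?(ltW K0)// mulrC ler_wpM2r ?prodr_ge0//.
  have S0 : 0 < \prod_i s i by exact: prodr_gt0.
  by rewrite wm ler_pdivlMr ?exprn_gt0// mulrC ler_pdivrMr.
apply: le_trans (iter_young_mono B_young m _ _ _ prod_le) _.
  by apply: prodr_ge0 => i _; rewrite (le_trans ler01).
apply: le_trans (iter_young_prod_submul B_young B_submul _ _ _ _ _ _ _) _.
- by rewrite exprn_ge0// ltW.
- by move=> i; rewrite mulr_ge0// ltW.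
rewrite -mulrA ler_wpM2l ?B0 ?exprn_ge0 ?(ltW K0)//.
have -> (x : R) : x ^+ m = \prod_(i < m) x by rewrite prodr_const card_ord.
rewrite -big_split/=; apply: ler_prod => i _.
rewrite B0/= ?(mulr_ge0 (ltW w0) (t0 i))//.
apply: le_trans (iter_young_submul B_young B_submul m _ _ (ltW w0) (t0 i)) _.
by rewrite ler_wpM2r ?B0// iter_young_submul ?powR_ge0// invr_ge0 ltW.
Qed.

(** Product over i of [half_vol_le_integral_large], estimated by integrating
[large_product_le] in its m independent variables. *)
Lemma vol_pow_le_prod_integral (m : nat) (f : 'I_m -> Rn R n -> R) Q
    (p lam : R) :
  (0 < m)%N -> 0 < lam -> (0 < vol Q -> 0 < p) -> measurable Q ->
  leb Q \is a fin_num ->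
  (forall i, measurable_fun setT (f i)) ->
  ((lam ^+ m)%:E < p%:E * \prod_(i < m) luxemburg B (f i) Q)%E ->
  0 < vol Q /\
  (((vol Q / 2) ^+ m)%:E <=
   (iter m B ((2 * B 1) ^+ m) *
    (iter m B (p `^ m%:R^-1) * iter m B lam^-1) ^+ m)%:E *
   \prod_(i < m) \int[leb]_(x in Q) (iter m B `|f i x|)%:E)%E.
Proof.
move=> m0 lam0 pv0 mQ Qfin mf ltp.
have lamm0 : 0 < lam ^+ m by exact: exprn_gt0.
have lux0 i : (0 < luxemburg B (f i) Q)%E.
  rewrite lt_neqAle luxemburg_ge0 andbT; apply: contraTneq ltp => lux0.
  by rewrite (bigD1 i)//= -lux0 mul0e mule0 -leNgt lee_fin ltW.
have v0 := vol_gt0_of_luxemburg _ _ (lux0 (Ordinal m0)).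
have p0 := pv0 v0; split=> //.
have [||||s [sP lam_lt]] := @lt_prode_lower R _ _ _ _ _ _ _ _ _ ltp => //.
- exact: index_enum_uniq.
- exact: ltW.
- by rewrite lee_fin ltW.
- by move=> i; exact: luxemburg_ge0.
have s0 i : 0 < s i by have [] := sP i (mem_index_enum i).
have sl i : ((s i)%:E < luxemburg B (f i) Q)%E.
  by have [] := sP i (mem_index_enum i).
move: lam_lt; rewrite -EFinM lte_fin => /ltW lam_le.
pose F i x := (large_young (2 * B 1 * (`|f i x| / s i)))%:E.
apply: (@le_trans _ _ (1 * \prod_(i < m) \int[leb]_(x in Q) F i x)%E).
  rewrite mul1e -[in leLHS](card_ord m) -prodr_const -prodEFin.
  apply: lee_prode => i; rewrite lee_fin divr_ge0 ?(ltW v0)//=.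
  exact: half_vol_le_integral_large.
apply: prod_integral_le => //.
- exact: index_enum_uniq.
- move=> i; apply: measurable_funTS; apply/measurable_EFinP.
  exact: measurable_large_quotient.
- move=> i; apply: measurable_funTS; apply/measurable_EFinP.
  exact: measurable_iter_young.
- by move=> i x; rewrite lee_fin large_young_ge0.
- by move=> i x; rewrite lee_fin iter_young_ge0.
- have K0 : 0 <= 2 * B 1 by rewrite mulr_ge0// young_ge0.
  rewrite lee_fin mulr_ge0 ?iter_young_ge0 ?exprn_ge0//.
  by rewrite mulr_ge0 ?iter_young_ge0 ?powR_ge0// invr_ge0 ltW.
move=> x; rewrite mul1e !prodEFin -EFinM lee_fin.
exact: large_product_le.
Qed.

End orlicz_average.

(** * The weak-type estimate *)

(** At each point at most one term of the sum of the restricted functions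
survives. *)
Lemma sum_disjoint_integral_le d (T : measurableType d) (R : realType)
    (mu : {measure set T -> \bar R}) (I : eqType) (t : seq I) (D : I -> set T)
    (e : I -> R) (h : T -> R) (g : T -> \bar R) :
  (forall i, measurable (D i)) -> measurable_fun setT h ->
  (forall i, 0 <= e i) -> (forall x, 0 <= h x) -> (forall x, 0 <= g x)%E ->
  pairwise (fun i j => ~~ `[< D j `&` D i !=set0 >]) t ->
  (forall i x, i \in t -> D i x -> ((e i * h x)%:E <= g x)%E) ->
  (\sum_(i <- t) (e i)%:E * \int[mu]_(x in D i) (h x)%:E <= \int[mu]_x g x)%E.
Proof.
move=> mD mh e0 h0 g0 disj eh_g.
pose H i x := ((fun x => (e i)%:E * (h x)%:E) \_ (D i))%E x.
have H0 i x : (0 <= H i x)%E.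
  by rewrite /H /patch; case: ifP => // _; rewrite mule_ge0// lee_fin.
rewrite (eq_bigr (fun i => \int[mu]_x H i x)%E); last first.
  move=> i _; rewrite -integral_mkcond ge0_integralZl//.
  - by apply: measurable_funTS; exact/measurable_EFinP.
  - by move=> x _; rewrite lee_fin.
  - by rewrite lee_fin.
rewrite -ge0_integral_sum//; last first.
  move=> i; apply/(measurable_restrictT _ (mD i)).
  by apply: measurable_funTS; apply: measurable_funeM; exact/measurable_EFinP.
apply: le_lower_integral => // x _; rewrite sume_ge0//=.
elim: t disj eh_g => [|i t IH]; first by rewrite big_nil.
rewrite /= => /andP[/allP it disj] eh_g; rewrite big_cons.
have [Dix|Dix] := pselect (D i x); last first.
  rewrite {1}/H /patch memNset// add0e; apply: IH => // j y jt.
  by apply: eh_g; rewrite inE jt orbT.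
rewrite big_seq big1 ?adde0.
  by rewrite /H /patch mem_set// -EFinM; apply: eh_g; rewrite ?mem_head.
move=> j jt; rewrite /H /patch memNset// => Djx.
by have /asboolP := it j jt; apply; exists x.
Qed.

Section maximal_function.
Context {R : realType} {n m : nat} {phi B : R -> R} {rho : R}.
Hypotheses (m_gt0 : (0 < m)%N)
  (phi_gt0 : forall t : R, 0 < t -> 0 < phi t) (rho_gt0 : 0 < rho)
  (phi_mono : forall t s : R, 0 < t -> t <= s -> phi t <= rho * phi s)
  (B_young : young B) (B_submul : submultiplicative B).

Local Notation psi := (psi_of m phi B).

Lemma psi_ge0 v : 0 <= psi v.
Proof. by apply: iter_young_ge0 => //; exact: powR_ge0. Qed.

Lemma psi_ess_nondecreasing v v' : 0 < v -> v <= v' ->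
  psi v <= iter m B (rho `^ m%:R^-1) * psi v'.
Proof.
move=> v0 vv'; have v'0 := lt_le_trans v0 vv'.
have phi0 := ltW (phi_gt0 _ v0); have phi'0 := ltW (phi_gt0 _ v'0).
have rhophi0 : 0 <= rho * phi v' by rewrite mulr_ge0// ltW.
apply: (@le_trans _ _ (iter m B ((rho * phi v') `^ m%:R^-1))).
  apply: iter_young_mono => //; first exact: powR_ge0.
  by apply: ge0_ler_powR; rewrite ?nnegrE// ?invr_ge0// phi_mono.
rewrite powRM ?(ltW rho_gt0)//.
by apply: iter_young_submul => //; exact: powR_ge0.
Qed.

(** Cost of replacing a cube by its fivefold dilation in psi(v) / v: the first
factor comes from essential monotonicity, the second from the volume. *)
Definition dilation_cst := iter m B (rho `^ m%:R^-1) * 5 ^+ n.+1.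

Lemma dilation_cst_gt0 : 0 < dilation_cst.
Proof.
by rewrite mulr_gt0 ?exprn_gt0// iter_young_gt0// powR_gt0.
Qed.

(** The average of u at the scale of the cube, normalized so as to be a lower
bound for the maximal function of u on the cube. *)
Definition cube_weight (u : Rn R n -> R) (y : 'rV[R]_n.+1 * R) : R :=
  psi (vol (cube_at y.1 y.2)) * fine (wmeasure u (dilate5 y.1 y.2)) /
  (vol (cube_at y.1 y.2) * dilation_cst).

Lemma wmeasure_dilate5_lty (u : Rn R n -> R) a l : weight u ->
  (wmeasure u (dilate5 a l) < +oo)%E.
Proof. by case=> _ _; apply; exact: compact_cube_at. Qed.

Lemma wmeasure_ge0 (u : Rn R n -> R) D : (forall x, 0 <= u x) ->
  (0 <= wmeasure u D)%E.
Proof. by move=> u0; apply: integral_ge0 => x _; rewrite lee_fin. Qed.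

Lemma cube_weight_ge0 u y : weight u -> 0 <= cube_weight u y.
Proof.
case=> _ u0 _; rewrite divr_ge0// mulr_ge0 ?psi_ge0 ?vol_cube_at_ge0//.
  by rewrite fine_ge0// wmeasure_ge0.
exact/ltW/dilation_cst_gt0.
Qed.

Lemma maximal_L_ge0 (u : Rn R n -> R) x : (0 <= maximal_L psi u x)%E.
Proof.
pose Q := cube_at (x : 'rV[R]_n.+1) 1.
apply: (@le_trans _ _ ((psi (vol Q))%:E * avg Q (fun y => `|u y|%R))%E).
  rewrite mule_ge0 ?lee_fin ?psi_ge0// mule_ge0 ?lee_fin ?invr_ge0//.
    exact: vol_cube_at_ge0.
  by apply: integral_ge0 => y _; rewrite lee_fin.
apply: ereal_sup_ubound; exists Q => //; split.
  by apply/cubeP; exists x, 1.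
by apply/in_cube_at => i; rewrite lexx lerDl ler01.
Qed.

(** The fivefold dilation is one of the cubes of the supremum that defines the
maximal function. *)
Lemma cube_weight_le_maximal u y x : weight u -> 0 < y.2 ->
  0 < vol (cube_at y.1 y.2) -> cube_at y.1 y.2 x ->
  ((cube_weight u y)%:E <= maximal_L psi u x)%E.
Proof.
move=> wu l0 v0 yx; have [mu u0 _] := wu.
set v := vol (cube_at y.1 y.2); pose Q' := dilate5 y.1 y.2.
have vv' : v <= vol Q' by exact: vol_dilate5_ge.
have v'5 : vol Q' <= 5 ^+ n.+1 * v by exact: vol_dilate5_le.
have v'0 : 0 < vol Q' by exact: lt_le_trans vv'.
apply: (@le_trans _ _
  ((psi (vol Q'))%:E * avg Q' (fun y => `|u y|%R))%E); last first.
  apply: ereal_sup_ubound; exists Q' => //; split; last exact: sub_dilate5.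
  by apply/cubeP; eexists; eexists; split; last reflexivity; rewrite mulr_gt0.
have -> : avg Q' (fun y => `|u y|) = ((vol Q')^-1 * fine (wmeasure u Q'))%:E.
  rewrite EFinM fineK; last first.
    by rewrite ge0_fin_numE ?wmeasure_ge0//; exact: wmeasure_dilate5_lty.
  by congr (_ * _)%E; apply: eq_integral => z _; rewrite ger0_norm.
rewrite -EFinM lee_fin /cube_weight -/v -/Q' /dilation_cst.
have U0 : 0 <= fine (wmeasure u Q') by rewrite fine_ge0// wmeasure_ge0.
set c := iter m B _; set U := fine _ in U0 *.
have c0 : 0 < c by rewrite iter_young_gt0// powR_gt0.
have psile : psi v <= c * psi (vol Q') by exact: psi_ess_nondecreasing.
have psi'0 := psi_ge0 (vol Q').
rewrite ler_pdivrMr ?mulr_gt0 ?exprn_gt0//.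
apply: (@le_trans _ _ (c * psi (vol Q') * U)); first by rewrite ler_wpM2r.
have -> : psi (vol Q') * ((vol Q')^-1 * U) * (v * (c * 5 ^+ n.+1)) =
    (c * psi (vol Q') * U) * ((5 ^+ n.+1 * v) / vol Q') by ring.
by rewrite ler_peMr ?mulr_ge0 ?(ltW c0)// ler_pdivlMr// mul1r.
Qed.

(** The factor 2 comes from the truncation, the dilation constant from the
normalization of the cube weights, and the last factor from the rescaling of the
m truncated arguments by 2 * B 1. *)
Definition weak_type_cst := (2 * dilation_cst) ^+ m * iter m B ((2 * B 1) ^+ m).

Lemma weak_type_cst_gt0 : 0 < weak_type_cst.
Proof.
have c0 := dilation_cst_gt0; have B1 : 0 < B 1 by exact: young_gt0.
apply: mulr_gt0; first exact/exprn_gt0/mulr_gt0.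
by apply: iter_young_gt0 => //; exact/exprn_gt0/mulr_gt0.
Qed.

Context {u : 'I_m -> Rn R n -> R} {f : 'I_m -> Rn R n -> R}.
Hypotheses (u_weight : forall i, weight (u i))
  (f_meas : forall i, measurable_fun setT (f i)).

Definition geometric_weight (x : Rn R n) : R :=
  \prod_(i < m) (u i x `^ m%:R^-1).

Lemma geometric_weight_ge0 x : 0 <= geometric_weight x.
Proof. by apply: prodr_ge0 => i _; exact: powR_ge0. Qed.

Lemma measurable_geometric_weight : measurable_fun setT geometric_weight.
Proof.
apply: measurable_prod => i _; have [mu _ _] := u_weight i.
exact: (measurableT_comp (measurable_powR _) mu).
Qed.

Lemma geometric_weight_pow x : geometric_weight x ^+ m = \prod_i u i x.
Proof.
rewrite -prodrXl; apply: eq_bigr => i _; have [_ u0 _] := u_weight i.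
exact: powR_inv_exprK.
Qed.

(** The cubes that witness membership in the level set at height lam^m; a cube
is encoded by its lowest vertex and its side. *)
Definition exceeds (lam : R) (y : 'rV[R]_n.+1 * R) := 0 < y.2 /\
  ((lam ^+ m)%:E < (phi (vol (cube_at y.1 y.2)))%:E *
     \prod_(i < m) luxemburg B (f i) (cube_at y.1 y.2))%E.

Local Notation energy y i :=
  (\int[leb]_(x in cube_at y.1 y.2) (iter m B `|f i x|)%:E)%E.

Lemma energy_ge0 (D : set (Rn R n)) i :
  (0 <= \int[leb]_(x in D) (iter m B `|f i x|)%:E)%E.
Proof. by apply: integral_ge0 => x _; rewrite lee_fin iter_young_ge0. Qed.

(** Multiplies the inequality of Hoelder on the dilated cube by
[vol_pow_le_prod_integral]; the powers of the volume are absorbed in the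
weights of the cube. *)
Lemma exceeds_wmeasure_le lam y : 0 < lam -> exceeds lam y ->
  0 < vol (cube_at y.1 y.2) /\
  ((wmeasure geometric_weight (dilate5 y.1 y.2)) ^+ m <=
   (weak_type_cst * iter m B lam^-1 ^+ m)%:E *
   \prod_(i < m) ((cube_weight (u i) y)%:E * energy y i))%E.
Proof.
move=> lam0 [y0 lam_lt].
have [] := @vol_pow_le_prod_integral R n B B_young B_submul m f _ _ lam m_gt0
  lam0 (phi_gt0 _) (measurable_cube_at _ _) (leb_cube_at_fin _ _) f_meas lam_lt.
set v := vol _; set P := (\prod_(i < m) _)%E => v0 vP; split=> //.
have D0 := dilation_cst_gt0.
have P0 : (0 <= P)%E by apply: prode_ge0 => i _; exact: energy_ge0.
pose U i := fine (wmeasure (u i) (dilate5 y.1 y.2)).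
have Ufin i : wmeasure (u i) (dilate5 y.1 y.2) = (U i)%:E.
  rewrite fineK// ge0_fin_numE; first exact: wmeasure_dilate5_lty.
  by have [_ u0 _] := u_weight i; exact: wmeasure_ge0.
have U0 i : 0 <= U i.
  by rewrite fine_ge0//; have [_ u0 _] := u_weight i; exact: wmeasure_ge0.
apply: (@le_trans _ _ (\prod_i U i)%:E).
  rewrite -prodEFin -(eq_bigr _ (fun i _ => Ufin i)).
  apply: holder_integral_prod => //.
  - exact: measurable_cube_at.
  - by move=> i; have [mu _ _] := u_weight i; exact: measurable_funTS.
  - exact: geometric_weight_ge0.
  - by move=> i x; have [_ u0 _] := u_weight i.
  - by move=> x; rewrite geometric_weight_pow.
  - by move=> i; exact: wmeasure_dilate5_lty.
have prodU0 : 0 <= \prod_i U i by exact: prodr_ge0.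
have v2m : 0 < (v / 2) ^+ m by rewrite exprn_gt0// divr_gt0.
rewrite big_split/= prodEFin -/P muleA -EFinM.
have -> : (\prod_i U i)%:E = ((\prod_i U i / (v / 2) ^+ m)%:E *
    ((v / 2) ^+ m)%:E)%E by rewrite -EFinM divfK// gt_eqF.
apply: (@le_trans _ _ ((\prod_i U i / (v / 2) ^+ m)%:E * (_ * P))%E).
  by apply: lee_wpmul2l; [rewrite lee_fin divr_ge0// ltW|exact: vP].
rewrite muleA -EFinM le_eqVlt; apply/orP; left; apply/eqP; congr (_%:E * _)%E.
rewrite /cube_weight -/v -/(psi v) -/U /weak_type_cst.
move: dilation_cst D0 => D D0.
have -> : \prod_(i < m) (psi v * U i / (v * D)) =
    (psi v / (v * D)) ^+ m * \prod_i U i.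
  have -> (x : R) : x ^+ m = \prod_(i < m) x by rewrite prodr_const card_ord.
  by rewrite -big_split/=; apply: eq_bigr => i _; ring.
rewrite !expr_div_n !exprMn; field.
by rewrite !expf_neq0 ?gt_eqF// ?pnatr_eq0.
Qed.

Lemma level_set_sub lam :
  [set x | ((lam ^+ m)%:E < maximal_multi phi B f x)%E] `<=`
  \bigcup_(y in exceeds lam) cube_at y.1 y.2.
Proof.
move=> x /ereal_sup_gt[_ [Q [/cubeP[a [l [l0 ->]]] Qx] <-] lam_lt].
by exists (a, l).
Qed.

(** On each cube its weight is a lower bound of the maximal function, and the
cubes do not overlap. *)
Lemma sum_weight_energy_le lam t i : 0 < lam ->
  (forall y, y \in t -> exceeds lam y) ->
  pairwise (fun y z => ~~ cubes_meet z y) t ->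
  (\sum_(y <- t) (cube_weight (u i) y)%:E * energy y i <=
   \int[leb]_x ((iter m B `|f i x|)%:E * maximal_L psi (u i) x))%E.
Proof.
move=> lam0 tQ disj.
apply: (@sum_disjoint_integral_le _ _ _ leb _ t (fun y => cube_at y.1 y.2)).
- by move=> y; exact: measurable_cube_at.
- exact: measurable_iter_young.
- by move=> y; exact: cube_weight_ge0.
- by move=> x; rewrite iter_young_ge0.
- by move=> x; rewrite mule_ge0 ?maximal_L_ge0// lee_fin iter_young_ge0.
- exact: disj.
move=> y x /tQ Qy yx; have [y0 _] := Qy.
have [v0 _] := exceeds_wmeasure_le _ _ lam0 Qy.
rewrite EFinM muleC lee_wpmul2l ?lee_fin ?iter_young_ge0//.
exact: cube_weight_le_maximal.
Qed.

(** The products on the right may involve 0 * +oo = 0, so three cases are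
distinguished. If some integral vanishes, then each dilated cube has measure 0
by [exceeds_wmeasure_le]; if all are positive and one is infinite, there is
nothing to prove; if all are positive and finite, [holder_sum] applies with
these integrals as bounds. *)
Lemma weak_type_estimate lam : 0 < lam ->
  ((wmeasure geometric_weight
     [set x | ((lam ^+ m)%:E < maximal_multi phi B f x)%E]) ^+ m <=
   (weak_type_cst * iter m B lam^-1 ^+ m)%:E *
   \prod_(i < m)
     \int[leb]_x ((iter m B `|f i x|)%:E * maximal_L psi (u i) x))%E.
Proof.
move=> lam0; set W := wmeasure _ _.
pose I i := (\int[leb]_x ((iter m B `|f i x|)%:E * maximal_L psi (u i) x))%E.
rewrite -/(\prod_(i < m) I i)%E; set k := weak_type_cst * _.
have k0 : 0 < k.
  rewrite mulr_gt0 ?weak_type_cst_gt0// exprn_gt0//.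
  by rewrite iter_young_gt0// invr_gt0.
have I0 i : (0 <= I i)%E.
  apply: integral_ge0 => x _.
  by rewrite mule_ge0 ?maximal_L_ge0// lee_fin iter_young_ge0.
have W0 : (0 <= W)%E by apply: wmeasure_ge0; exact: geometric_weight_ge0.
have WG G : (forall t, (forall y, y \in t -> exceeds lam y) ->
    pairwise (fun y z => ~~ cubes_meet z y) t ->
    \sum_(y <- t) wmeasure geometric_weight (dilate5 y.1 y.2) <= G)%E ->
    (W <= G)%E.
  move=> tG; apply: le_trans (wmeasure_cubes_le (exceeds lam) _ _ _
    measurable_geometric_weight geometric_weight_ge0 tG); last by move=> y [].
  apply: le_lower_integral; first exact: level_set_sub.
    by move=> x _; rewrite lee_fin geometric_weight_ge0.
  by move=> x _; rewrite lee_fin geometric_weight_ge0/=.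
have aI y i : exceeds lam y ->
    ((cube_weight (u i) y)%:E * energy y i <= I i)%E.
  move=> Qy; have := @sum_weight_energy_le lam [:: y] i lam0 _ isT.
  rewrite big_seq1; apply => z; rewrite inE => /eqP->; exact: Qy.
have a0 y i : (0 <= (cube_weight (u i) y)%:E * energy y i)%E.
  by rewrite mule_ge0 ?energy_ge0// lee_fin cube_weight_ge0.
have Wy0 y : (0 <= wmeasure geometric_weight (dilate5 y.1 y.2))%E.
  by apply: wmeasure_ge0; exact: geometric_weight_ge0.
have [[i Ii0]|noI0] := pselect (exists i, I i = 0%E).
  have W_le0 : (W <= 0)%E.
    apply: WG => t tQ _; rewrite big_seq; apply: sume_le0 => y /tQ Qy.
    rewrite leNgt; apply/negP => Wy.
    have [_] := exceeds_wmeasure_le _ _ lam0 Qy.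
    rewrite [X in (_ <= _ * X)%E](bigD1 i)//=.
    have -> : ((cube_weight (u i) y)%:E * energy y i)%E = 0%E.
      by apply/eqP; rewrite eq_le a0 andbT -Ii0 aI.
    by rewrite mul0e mule0 leNgt expe_gt0.
  have -> : W = 0%E by apply/eqP; rewrite eq_le W_le0 W0.
  rewrite -EFin_expe expr0n gtn_eqF//= mule_ge0 ?lee_fin ?(ltW k0)//.
  exact: prode_ge0.
have Igt0 i : (0 < I i)%E.
  by rewrite lt0e I0 andbT; apply/eqP => Ii0; apply: noI0; exists i.
have [[i Iioo]|noIoo] := pselect (exists i, I i = +oo%E).
  rewrite (bigD1 i)//= Iioo gt0_mulye ?gt0_muley ?lte_fin ?leey//.
  by elim/big_ind: _ => // x y; exact: mule_gt0.
pose A i := fine (I i).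
have IA i : I i = (A i)%:E.
  rewrite fineK// ge0_fin_numE// ltey; apply/eqP => Iioo.
  by apply: noIoo; exists i.
have A0 i : 0 < A i by rewrite -lte_fin -IA.
rewrite (eq_bigr _ (fun i _ => IA i)) prodEFin -EFinM.
(* The sum over the disjoint cubes, divided by the m-th root of k, is bounded by
   the discrete Hoelder inequality. *)
suff W_le : (W <= ((k * \prod_i A i) `^ m%:R^-1)%:E)%E.
  apply: le_trans (lee_expe2r _ m _ _ W0 W_le) _.
  rewrite -EFin_expe powR_inv_exprK// mulr_ge0 ?(ltW k0)//.
  by apply: prodr_ge0 => i _; exact: ltW.
apply: WG => t tQ disj.
pose b y := fine (wmeasure geometric_weight (dilate5 y.1 y.2)).
pose a i y := fine ((cube_weight (u i) y)%:E * energy y i)%E.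
have aE i y : y \in t -> ((cube_weight (u i) y)%:E * energy y i)%E = (a i y)%:E.
  move=> yt; rewrite fineK// ge0_fin_numE ?a0//.
  by apply: le_lt_trans (aI _ _ (tQ y yt)) _; rewrite IA ltry.
have bE y : y \in t ->
    wmeasure geometric_weight (dilate5 y.1 y.2) = (b y)%:E.
  move=> yt; rewrite fineK// ge0_fin_numE//.
  apply: (@holder_integral_lty _ _ _ _ _ m _ u) => //.
  - exact: measurable_cube_at.
  - by move=> i; have [mu _ _] := u_weight i; exact: measurable_funTS.
  - exact: geometric_weight_ge0.
  - by move=> i x; have [_ u0 _] := u_weight i.
  - by move=> x; rewrite geometric_weight_pow.
  - by move=> i; exact: wmeasure_dilate5_lty.
rewrite big_seq (eq_bigr _ bE) -big_seq sumEFin lee_fin.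
rewrite powRM ?(ltW k0) ?prodr_ge0//; last by move=> i _; exact: ltW.
rewrite mulrC -ler_pdivrMr ?powR_gt0// mulr_suml.
apply: (@holder_sum _ _ _ _ _ a) => // [y|i y|y yt|i].
- by rewrite divr_ge0 ?fine_ge0 ?powR_ge0.
- by rewrite fine_ge0.
- rewrite expr_div_n powR_inv_exprK ?(ltW k0)// ler_pdivrMr// -lee_fin.
  have [_] := exceeds_wmeasure_le _ _ lam0 (tQ y yt).
  rewrite bE// (eq_bigr _ (fun i _ => aE i y yt)) prodEFin -EFin_expe -EFinM.
  by rewrite mulrC.
- rewrite -lee_fin -IA -sumEFin big_seq -(eq_bigr _ (aE i)) -big_seq.
  exact: (sum_weight_energy_le lam t i).
Qed.

End maximal_function.

Theorem theorem3p13 (R : realType) (n m : nat) (hm : (0 < m)%N)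
    (phi B : R -> R) (u : 'I_m -> Rn R n -> R)
    (phi_gt0 : forall t : R, 0 < t -> 0 < phi t)
    (phi_mono : ess_nondecreasing phi)
    (phi_lim : phi t / t @[t --> +oo] --> (0 : R))
    (B_young : young B)
    (B_submul : submultiplicative B)
    (u_weight : forall i : 'I_m, weight (u i)) :
  exists2 C : R, 0 < C &
    forall f : 'I_m -> Rn R n -> R,
      (forall i : 'I_m, measurable_fun [set: Rn R n] (f i)) ->
      (ereal_sup
        [set (((iter m B lam^-1)^-1) ^+ m)%:E *
             wmeasure (fun x => \prod_(i < m) (u i x `^ m%:R^-1))%R
               [set x | (lam ^+ m)%:E < maximal_multi phi B f x] ^+ m
        | lam in [set lam : R | (0 < lam)%R]]
      <= C%:E * \prod_(i < m)
           \int[leb]_x ((iter m B `|f i x|)%:E *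
                        maximal_L (psi_of m phi B) (u i) x))%E.
Proof.
have [rho rho0 phi_le] := phi_mono.
exists (@weak_type_cst R n m B rho); first exact: weak_type_cst_gt0.
move=> f mf; apply: ge_ereal_sup => _ [lam lam0 <-].
have Bl0 : 0 < iter m B lam^-1 by rewrite iter_young_gt0// invr_gt0.
rewrite exprVn lee_pdivrMl ?exprn_gt0// muleA -EFinM [_ ^+ m * _]mulrC.
exact: (weak_type_estimate hm phi_gt0 rho0 phi_le B_young B_submul).
Qed.
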